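(* For any integers $t\geq 4$ and $k$ with $t+1\leq k\leq \binom{t}{2}$, there exists a $t$-chromatic $P_5$-free graph $G$ such that the reconfiguration graph $\mathcal{R}_k(G)$ is disconnected.
   Context: All graphs are finite and simple. $P_\ell$ denotes the path on $\ell$ vertices; a graph is $P_\ell$-free if it contains no induced subgraph isomorphic to $P_\ell$. A $k$-coloring of $G$ is a proper vertex coloring $\phi:V(G)\to\{1,\dots,k\}$, i.e. $\phi(u)\neq\phi(v)$ for adjacent $u,v$ (not all colors need be used). $G$ is $t$-chromatic if its chromatic number $\chi(G)$ equals $t$. The reconfiguration graph $\mathcal{R}_k(G)$ has as vertices all $k$-colorings of $G$, two $k$-colorings being joined by an edge if they differ in color on exactly one vertex of $G$. *)

(* Defs.v *)
From mathcomp Require Import all_boot.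

Set Implicit Arguments.
Unset Strict Implicit.
Unset Printing Implicit Defensive.

Record sgraph := SGraph {
  vertex :> finType;
  adj : rel vertex;
  adj_sym : symmetric adj;
  adj_irrefl : irreflexive adj }.

Definition graph_iso (G H : sgraph) : Prop :=
  exists2 f : G -> H, bijective f & forall x y : G, adj (f x) (f y) = adj x y.

Section Induced.
Variables (G : sgraph) (A : {set G}).

Definition induced_adj : rel {x : G | x \in A} :=
  fun u v => adj (val u) (val v).

Lemma induced_adj_sym : symmetric induced_adj.
Proof. by move=> u v; apply: adj_sym. Qed.

Lemma induced_adj_irrefl : irreflexive induced_adj.
Proof. by move=> u; apply: adj_irrefl. Qed.

Definition induced : sgraph := SGraph induced_adj_sym induced_adj_irrefl.

End Induced.

Section PathGraph.
Variable l : nat.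

Definition path_adj : rel 'I_l := fun i j => (i.+1 == j) || (j.+1 == i).

Lemma path_adj_sym : symmetric path_adj.
Proof. by move=> i j; rewrite /path_adj orbC. Qed.

Lemma path_adj_irrefl : irreflexive path_adj.
Proof. by move=> i; rewrite /path_adj orbb gtn_eqF. Qed.

(* Following the convention for P_l, l counts vertices, not edges. *)
Definition path_graph : sgraph := SGraph path_adj_sym path_adj_irrefl.

End PathGraph.

Definition path_free (l : nat) (G : sgraph) : Prop :=
  forall A : {set G}, ~ graph_iso (induced A) (path_graph l).

Section Coloring.
Variables (G : sgraph) (k : nat).

Definition proper_coloring (f : {ffun G -> 'I_k}) : bool :=
  [forall x, forall y, adj x y ==> (f x != f y)].

Definition coloring := {f : {ffun G -> 'I_k} | proper_coloring f}.

Definition colorable : bool :=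
  [exists f : {ffun G -> 'I_k}, proper_coloring f].

Definition reconf_adj : rel coloring :=
  fun f g => #|[set x | val f x != val g x]| == 1.

Lemma reconf_adj_sym : symmetric reconf_adj.
Proof.
move=> f g; rewrite /reconf_adj; congr (_ == 1).
by apply: eq_card => x; rewrite !inE eq_sym.
Qed.

Lemma reconf_adj_irrefl : irreflexive reconf_adj.
Proof.
move=> f; rewrite /reconf_adj (_ : [set x | _] = set0) ?cards0 //.
by apply/setP => x; rewrite !inE eqxx.
Qed.

Definition reconf : sgraph := SGraph reconf_adj_sym reconf_adj_irrefl.

End Coloring.

Lemma colorable_ex (G : sgraph) : exists k, colorable G k.
Proof.
exists #|G|; apply/existsP; exists [ffun x : G => enum_rank x].
apply/forallP => x; apply/forallP => y; apply/implyP => xy.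
rewrite !ffunE; apply/eqP => /enum_rank_inj exy.
by rewrite exy adj_irrefl in xy.
Qed.

Definition chromatic_number (G : sgraph) : nat := ex_minn (colorable_ex G).

Definition disconnected (G : sgraph) : Prop :=
  exists x y : G, ~~ connect (@adj G) x y.

(* Main.v *)
Require Import Defs.
From mathcomp Require Import all_boot.
From mathcomp Require Import zify.

(** The complement of the line graph of the subdivision of a graph [F] is
    [2K_2]-free, hence [P_5]-free. Its vertices are the incident pairs [(i, e)] of
    [F], and both [(i, e) |-> i] and [(i, e) |-> e] are proper colorings. The second
    one is frozen: an edge [e' <> e] has an end [a <> i], so [(i, e)] has the
    neighbor [(a, e')] of color [e']. When [F] has [t] vertices, contains a
    Hamiltonian cycle and has [k > t] edges, the cycle yields a clique
    [(i, {i, i + 1})] of size [t], while the coloring by edges is an isolated vertex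
    of [R_k(G)], which also contains the coloring by the [t] vertices of [F]. *)

Set Implicit Arguments.
Unset Strict Implicit.
Unset Printing Implicit Defensive.

Lemma exists_set_card (T : finType) (A B : {set T}) (k : nat) :
  A \subset B -> #|A| <= k -> k <= #|B| ->
  exists2 E : {set T}, (A \subset E) && (E \subset B) & #|E| = k.
Proof.
move=> sAB; elim: k => [|k IHk] leAk lekB.
  by exists A; [rewrite subxx | apply/eqP; rewrite eqn_leq leAk].
move: leAk; rewrite leq_eqVlt => /orP[/eqP eA|]; first by exists A; rewrite // subxx.
case/IHk => [|E /andP[sAE sEB] cE]; first exact: ltnW.
have /properP[_ [x Bx nEx]] : E \proper B by rewrite properEcard sEB cE.
exists (x |: E); last by rewrite cardsU1 nEx cE.
by rewrite (subset_trans sAE (subsetUr _ _)) subUset sub1set Bx.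
Qed.

Lemma cards2_mem_eq (T : finType) (A B : {set T}) (x y : T) :
  #|A| = 2 -> #|B| = 2 -> x != y ->
  x \in A -> y \in A -> x \in B -> y \in B -> A = B.
Proof.
move=> cA cB xy xA yA xB yB; have cxy : #|[set x; y]| = 2 by rewrite cards2 xy.
have pairE (C : {set T}) : #|C| = 2 -> x \in C -> y \in C -> [set x; y] = C.
  by move=> cC xC yC; apply/eqP; rewrite eqEcard cxy cC subUset !sub1set xC yC.
by rewrite -(pairE A) // -(pairE B).
Qed.

Lemma ordS_neq n (i : 'I_n) : 1 < n -> ordS i != i.
Proof.
move=> n1; rewrite -val_eqE /=; have := ltn_ord i.
by rewrite leq_eqVlt => /orP[/eqP e|lt]; [rewrite e modnn | rewrite modn_small]; lia.
Qed.

Lemma ordS2_neq n (i : 'I_n) : 2 < n -> ordS (ordS i) != i.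
Proof.
move=> n2; rewrite -val_eqE /=; have := ltn_ord i.
(* If [i = n - 1], the first successor wraps to [0] and the second is [1 < i]. Otherwise only the
   second can wrap, at [i = n - 2], to [0 < i]. *)
rewrite leq_eqVlt => /orP[/eqP e|lt]; first by rewrite e modnn modn_small; lia.
rewrite (modn_small lt); move: lt.
by rewrite leq_eqVlt => /orP[/eqP e|lt]; [rewrite e modnn | rewrite modn_small]; lia.
Qed.

(** Two distinct [i], [j] with the same edge would be successors of each other, so two steps along
    the cycle would return to [i]. *)
Lemma cycle_edge_inj n :
  2 < n -> injective (fun i : 'I_n => [set i; ordS i]).
Proof.
move=> n2 i j /= eij; apply: contraTeq isT => nij.
have /setP/(_ i) := eij; rewrite !inE eqxx (negPf nij) /= => /esym/eqP ei.
have /setP/(_ j) := eij; rewrite !inE eqxx eq_sym (negPf nij) /= => /eqP ej.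
by have := ordS2_neq i n2; rewrite -ej -ei eqxx.
Qed.

Lemma proper_coloringP (G : sgraph) (k : nat) (f : {ffun G -> 'I_k}) :
  reflect (forall x y, adj x y -> f x != f y) (proper_coloring f).
Proof.
by apply: (iffP forallP) => [h x y|h x];
  [move/forallP/(_ y)/implyP: (h x) | apply/forallP => y; apply/implyP/h].
Qed.

Lemma clique_leq_colors (G : sgraph) (t k : nat) (c : 'I_t -> G) :
  (forall i j, i != j -> adj (c i) (c j)) -> colorable G k -> t <= k.
Proof.
move=> cl /existsP[f /proper_coloringP pf].
have inj : injective (f \o c).
  by move=> i j /= e; apply: contra_eq e => /cl/pf.
by have := leq_card _ inj; rewrite !card_ord.
Qed.

Lemma chromatic_number_clique (G : sgraph) (t : nat) (c : 'I_t -> G) :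
  (forall i j, i != j -> adj (c i) (c j)) -> colorable G t ->
  chromatic_number G = t.
Proof.
move=> cl colt; rewrite /chromatic_number; case: ex_minnP => m colm minm.
by apply/eqP; rewrite eqn_leq minm // (clique_leq_colors cl colm).
Qed.

(** The first step of a walk leaving [f] recolors a single vertex [x]; the neighbor of [x] that
    already has the new color keeps it, a conflict. Hence [f] is isolated. *)
Lemma frozen_connect (G : sgraph) (k : nat) (f g : coloring G k) :
  (forall x c, c != val f x -> exists2 y, adj x y & val f y = c) ->
  connect (@reconf_adj G k) f g -> g = f.
Proof.
move=> frozen /connectP[[|h p] /= ph -> //].
have /andP[/cards1P[x dfh] _] := ph; have /setP/(_ x) := dfh.
rewrite !inE eqxx eq_sym => /frozen[y xy fy].
have nyx : y != x by apply: contraTneq xy => ->; rewrite adj_irrefl.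
have /setP/(_ y) := dfh; rewrite !inE (negPf nyx) => /negbFE/eqP fhy.
by have /proper_coloringP/(_ _ _ xy)/eqP[] := valP h; rewrite -fy fhy.
Qed.

(** Deleting the middle vertex of an induced [P_5] leaves an induced [2K_2]. *)
Lemma path5_free_2K2_free (G : sgraph) :
  (forall a b c d : G, adj a b -> adj c d ->
     ~~ [&& ~~ adj a c, ~~ adj a d, ~~ adj b c & ~~ adj b d]) ->
  path_free 5 G.
Proof.
move=> no2K2 A [f [g fK gK] fadj].
pose v n : G := val (g (inord n)).
have adjv m n : m < 5 -> n < 5 -> adj (v m) (v n) = (m.+1 == n) || (n.+1 == m).
  move=> m5 n5; have := fadj (g (inord m)) (g (inord n)).
  by rewrite !gK /= /path_adj !inordK // => ->.
by have := no2K2 (v 0) (v 1) (v 3) (v 4); rewrite !adjv //= => /(_ isT isT).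
Qed.

Section IncidenceGraph.
Variables (T : finType) (E : {set {set T}}).

Definition incidence := {p : T * {set T} | (p.2 \in E) && (p.1 \in p.2)}.

(** An incidence [(i, e)] is the edge of the subdivision joining [i] to the midpoint of [e];
    non-adjacency means sharing an end there. *)
Definition inc_adj : rel incidence :=
  fun x y => ((val x).1 != (val y).1) && ((val x).2 != (val y).2).

Lemma inc_adj_sym : symmetric inc_adj.
Proof. by move=> x y; rewrite /inc_adj ![_ == _ (val y)]eq_sym. Qed.

Lemma inc_adj_irrefl : irreflexive inc_adj.
Proof. by move=> x; rewrite /inc_adj eqxx. Qed.

Definition inc_graph : sgraph := SGraph inc_adj_sym inc_adj_irrefl.

Hypothesis E2 : forall e, e \in E -> #|e| = 2.

Lemma inc_graph_path5_free : path_free 5 inc_graph.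
Proof.
apply: path5_free_2K2_free => x y z w; rewrite /adj /= /inc_adj.
case: (val x) (valP x) (val y) (valP y) (val z) (valP z) (val w) (valP w).
move=> a ea /= /andP[aE aa] [b eb] /= /andP[bE bb].
move=> [c ec] /= /andP[cE cc] [d ed] /= /andP[dE dd].
move=> /andP[nab neab] /andP[ncd necd].
(* The four non-edges form a 4-cycle a, c, b, d, along which "same vertex" and
   "same edge" must alternate, so that two distinct edges share both their ends. *)
apply/negP => /and4P[]; rewrite !negb_and !negbK.
have no_double u v e e' : u != v -> e != e' -> e \in E -> e' \in E ->
    u \in e -> v \in e -> u \in e' -> v \in e' -> False.
  move=> uv /eqP ee' eE e'E ue ve ue' ve'; apply: ee'.
  by apply: (cards2_mem_eq _ _ uv) => //; apply: E2.
move=> /orP[]/eqP ac /orP[]/eqP ad /orP[]/eqP bc /orP[]/eqP bd; subst;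
  first [by rewrite eqxx in nab | by rewrite eqxx in neab
        |by rewrite eqxx in ncd | by rewrite eqxx in necd
        |by apply: no_double nab neab _ _ _ _ _ _].
Qed.

Definition end_coloring (k : nat) (w : T -> 'I_k) : {ffun inc_graph -> 'I_k} :=
  [ffun x => w (val x).1].

Lemma end_coloring_proper (k : nat) (w : T -> 'I_k) :
  injective w -> proper_coloring (end_coloring w).
Proof.
move=> injw; apply/proper_coloringP => x y /andP[nxy _].
by rewrite !ffunE (inj_eq injw).
Qed.

(** The color is the index of the edge in [E]; [e0] supplies the default that [enum_rank_in]
    requires. *)
Definition edge_coloring (e0 : {set T}) (e0E : e0 \in E) :
    {ffun inc_graph -> 'I_#|E|} :=
  [ffun x => enum_rank_in e0E (val x).2].

Lemma edge_coloring_proper e0 (e0E : e0 \in E) :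
  proper_coloring (edge_coloring e0E).
Proof.
apply/proper_coloringP => x y /andP[_]; rewrite !ffunE; apply: contraNneq.
have /andP[xE _] := valP x; have /andP[yE _] := valP y.
by move/enum_rank_in_inj->.
Qed.

Lemma edge_coloring_frozen e0 (e0E : e0 \in E) (x : inc_graph) (c : 'I_#|E|) :
  c != edge_coloring e0E x -> exists2 y, adj x y & edge_coloring e0E y = c.
Proof.
rewrite ffunE => nc; have cE := enum_valP c.
have [a] : exists a, a \in enum_val c :\ (val x).1.
  by apply/card_gt0P; have := cardsD1 (val x).1 (enum_val c); rewrite E2 //; lia.
rewrite !inE => /andP[nax ac].
have yP : (enum_val c \in E) && (a \in enum_val c) by rewrite cE.
exists (exist _ (a, enum_val c) yP); last by rewrite ffunE /= enum_valK_in.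
(* Were the two edges equal, [c] would be the color of [x] itself. *)
rewrite /= /inc_adj /= eq_sym nax; apply: contraNneq nc => ->.
by rewrite enum_valK_in.
Qed.

End IncidenceGraph.

Theorem theorem1p7 (t k : nat) (ht : 4 <= t) (hk1 : t + 1 <= k)
    (hk2 : k <= 'C(t, 2)) :
  exists G : sgraph,
    [/\ chromatic_number G = t, path_free 5 G & disconnected (reconf G k)].
Proof.
have t2 : 2 < t by apply: ltnW.
have ltk : t < k by rewrite -addn1.
pose edge (i : 'I_t) := [set i; ordS i].
have sCD : edge @: 'I_t \subset [set A : {set 'I_t} | #|A| == 2].
  apply/subsetP => _ /imsetP[i _ ->].
  by rewrite inE cards2 [i == _]eq_sym ordS_neq // ltnW.
(* [E] is the edge set of the base graph: the Hamiltonian cycle, with at most [t] edges, is enlarged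
   within the ['C(t, 2)] pairs to exactly [k] edges. *)
have [E /andP[sCE sED] cE] : exists2 E : {set {set 'I_t}},
    (edge @: 'I_t \subset E) && (E \subset [set A : {set 'I_t} | #|A| == 2])
    & #|E| = k.
  apply: exists_set_card sCD _ _; last by rewrite card_draws card_ord.
  by apply: leq_trans (leq_imset_card _ _) _; rewrite card_ord ltnW.
have E2 e : e \in E -> #|e| = 2 by move/(subsetP sED); rewrite inE => /eqP.
have edgeE i : edge i \in E by apply/(subsetP sCE)/imset_f.
subst k; exists (inc_graph E); split; last 1 first.
- have e0E := edgeE (Ordinal (ltnW (ltnW t2))).
  pose f : coloring (inc_graph E) #|E| := Sub _ (edge_coloring_proper e0E).
  have injw : injective (widen_ord (ltnW ltk)) by move=> i j [] /val_inj.
  pose g : coloring (inc_graph E) #|E| := Sub _ (end_coloring_proper E injw).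
  exists f, g; apply/negP => /frozen_connect efg.
  have {efg} : g = f by apply: efg; apply: edge_coloring_frozen.
  (* Color number [t] separates the two colorings: [f] gives it to every incidence of the
     corresponding edge, whereas [g] uses only colors below [t]. *)
  pose c := Ordinal ltk; have cE := enum_valP c.
  have /card_gt0P[a ac] : 0 < #|enum_val c| by rewrite E2.
  have xP : (enum_val c \in E) && (a \in enum_val c) by rewrite cE.
  pose x : inc_graph E := exist _ (a, enum_val c) xP.
  move/(congr1 (fun h : coloring _ _ => val (val h x))).
  rewrite /= !ffunE /= enum_valK_in /= => eat.
  by have := ltn_ord a; rewrite eat ltnn.
- have edgeP i : (edge i \in E) && (i \in edge i) by rewrite edgeE !inE eqxx.
  pose v i : inc_graph E := exist _ (i, edge i) (edgeP i).
  apply: (chromatic_number_clique (c := v)).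
    by move=> i j nij; rewrite /= /inc_adj /= nij (inj_eq (cycle_edge_inj t2)).
  by apply/existsP; exists (end_coloring E id); apply: end_coloring_proper.
- exact: inc_graph_path5_free.
Qed.
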